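(* Let $A$ and $B$ be finite lists of distinct indeterminates (all the elements of $A$ and $B$ together being distinct indeterminates), with $|A|=m$ and $|B|=n$, and let $f,g$ be the monic polynomials $$f=\prod_{\alpha\in A}(x-\alpha),\qquad g=\prod_{\beta\in B}(x-\beta)\ \in\ \mathbb{Z}[\alpha\in A,\ \beta\in B][x].$$ Let $p,q\ge 0$ be integers such that $d:=p+q$ satisfies $d<\min\{m,n\}$, or $d=\min\{m,n\}$ if $m\neq n$. Then $$\operatorname{Sres}_d(f,g)=\frac{(-1)^{p(m-d)}}{\binom{d}{p}}\;\operatorname{Sylv}^{p,q}(A,B;x).$$
   Context: Subresultants. Let $f=a_mx^m+\cdots+a_0$ and $g=b_nx^n+\cdots+b_0$ be polynomials with coefficients in a commutative ring, and set $a_\ell=0$ for $\ell<0$ or $\ell>m$, and $b_\ell=0$ for $\ell<0$ or $\ell>n$. For $0\le d<\min\{m,n\}$, or $d=\min\{m,n\}$ if $m\ne n$, the $d$-th subresultant polynomial $\operatorname{Sres}_d(f,g)$ is the determinant of the $(m+n-2d)\times(m+n-2d)$ matrix defined as follows. Its first $n-d$ rows come from $f$: for $1\le i\le n-d$, row $i$ has entry $a_{m-j+i}$ in column $j$ for $1\le j\le m+n-2d-1$, and entry $x^{n-d-i}f(x)$ in the last column. Its last $m-d$ rows come from $g$: for $1\le i\le m-d$, row $n-d+i$ has entry $b_{n-j+i}$ in column $j$ for $1\le j\le m+n-2d-1$, and entry $x^{m-d-i}g(x)$ in the last column. Sylvester's double sum. For finite lists $X,Y$ put $R(X,Y):=\prod_{x\in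 X,\,y\in Y}(x-y)$, and for a single element $x$ put $R(x,Y):=\prod_{y\in Y}(x-y)$ (empty products equal $1$). For $0\le p\le |A|$ and $0\le q\le |B|$, $$\operatorname{Sylv}^{p,q}(A,B;x):=\sum_{\substack{A'\subset A,\ B'\subset B\\ |A'|=p,\ |B'|=q}}R(x,A')\,R(x,B')\,\frac{R(A',B')\,R(A\backslash A',B\backslash B')}{R(A',A\backslash A')\,R(B',B\backslash B')},$$ where the sum is over all sublists (subsets) $A'$ of $A$ of size $p$ and $B'$ of $B$ of size $q$ ($A'=A$ and $B'=B$ allowed), and the expression is a polynomial in $x$ with coefficients in the field of rational functions over $\mathbb{Q}$ in the indeterminates of $A$ and $B$. *)

(* Defs.v *)
From mathcomp Require Export all_boot all_order all_algebra.
From mathcomp Require Export mpoly.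

Set Implicit Arguments.
Unset Strict Implicit.
Unset Printing Implicit Defensive.

Import GRing.Theory.

Local Open Scope ring_scope.

(* Coefficients of h_k x^k + ... + h_0, extended by 0 to indices l < 0 and
   l > k. The formal degree k is a parameter: the leading coefficient h_k is
   allowed to vanish. *)
Definition formal_coef (R : comNzRingType) (k : nat) (h : {poly R}) (l : int) : R :=
  if (0 <= l <= k%:Z)%R then h`_(`|l|%N) else 0.

(* The c rows coming from h (of formal degree k) in the N-column matrix
   defining a subresultant. Rows and columns are numbered from 0, so the entry
   h_(k-j+i) keeps its form, while the power of x in row i is c - (i + 1). *)
Definition Sres_rows (R : comNzRingType) (k c N : nat) (h : {poly R}) :
    'M[{poly R}]_(c, N) :=
  \matrix_(i < c, j < N)
    (if j.+1 == N then 'X^(c - i.+1) * h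
     else (formal_coef k h (k%:Z - j%:Z + i%:Z))%:P).

(* d-th subresultant of f, g of formal degrees m, n. It is meaningful for
   d <= min(m, n), where (n - d) + (m - d) = m + n - 2 d. *)
Definition Sres (R : comNzRingType) (m n d : nat) (f g : {poly R}) : {poly R} :=
  \det (col_mx (Sres_rows m (n - d) (n - d + (m - d)) f)
               (Sres_rows n (m - d) (n - d + (m - d)) g)).

Definition Rprod (R : comNzRingType) (X Y : seq R) : R :=
  \prod_(x <- X) \prod_(y <- Y) (x - y).

Definition sublist (T : Type) (k : nat) (A : k.-tuple T) (S : {set 'I_k}) : seq T :=
  [seq tnth A i | i in S].

(* R(x, Y), for a list Y of scalars, as a polynomial in x. *)
Definition RX (K : comNzRingType) (Y : seq K) : {poly K} :=
  Rprod [:: 'X] [seq y%:P | y <- Y].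

Definition Sylv (K : fieldType) (p q m n : nat)
    (A : m.-tuple K) (B : n.-tuple K) : {poly K} :=
  \sum_(S : {set 'I_m} | #|S| == p) \sum_(T : {set 'I_n} | #|T| == q)
    RX (sublist A S) * RX (sublist B T) *
    (Rprod (sublist A S) (sublist B T) *
       Rprod (sublist A (~: S)) (sublist B (~: T)) /
     (Rprod (sublist A S) (sublist A (~: S)) *
       Rprod (sublist B T) (sublist B (~: T))))%:P.

(* The m + n indeterminates, split into the lists A (the first m) and B (the
   last n). *)
Definition varsA (R : nzRingType) (m n : nat) : m.-tuple {mpoly R[m + n]} :=
  [tuple 'X_(lshift n i) | i < m].

Definition varsB (R : nzRingType) (m n : nat) : n.-tuple {mpoly R[m + n]} :=
  [tuple 'X_(rshift m i) | i < n].

Definition polyA (m n : nat) : {poly {mpoly int[m + n]}} :=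
  \prod_(a <- varsA int m n) ('X - a%:P).

Definition polyB (m n : nat) : {poly {mpoly int[m + n]}} :=
  \prod_(b <- varsB int m n) ('X - b%:P).

Notation ratfun k := {fraction {mpoly rat[k]}}.

(* The inclusion Z[A, B] -> Q(A, B). *)
Definition toratfun (k : nat) (u : {mpoly int[k]}) : ratfun k :=
  tofrac (map_mpoly (intr : int -> rat) u).

(* Main.v *)
(* Both sides are polynomials in x of degree at most d. Deleting a root of f,
   the value of the double sum at a root alpha of f is
   (-1)^p g(alpha) times the coefficient of x^d in the double sum of
   (A minus alpha, B); row and column operations show that Sres_d(f, g)(alpha)
   is g(alpha) times the d-th principal subresultant of (f / (x - alpha), g).
   If m > d, then f has more than d roots, so induction on m gives the theorem
   together with the equality of the coefficients of x^d. In the base case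
   m = d the same induction, on the roots of g, reduces the coefficient of x^d
   to m = n = d, where it is a sum over A' of terms that all equal 1 by
   symmetric Lagrange interpolation, hence it is binomial(d, p). *)
Require Import Defs.
From mathcomp Require Import all_boot all_order all_algebra.
From mathcomp Require Import mpoly.
From mathcomp Require Import ring zify.

Set Implicit Arguments.
Unset Strict Implicit.
Unset Printing Implicit Defensive.

Import GRing.Theory.
Local Open Scope ring_scope.

(** * Interpolation, and products of differences over index sets *)

Lemma poly_interp_eq (K : fieldType) (I : finType) (a : I -> K) (X : {set I})
    (u v : {poly K}) :
  {in X &, injective a} -> (size u <= #|X|)%N -> (size v <= #|X|)%N ->
  {in X, forall i, u.[a i] = v.[a i]} -> u = v.
Proof.
move=> inj_a szu szv euv; apply/eqP; rewrite -subr_eq0.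
apply/eqP/(@roots_geq_poly_eq0 _ _ [seq a i | i in X]).
- by apply/allP=> _ /imageP[i iX ->]; rewrite rootE !hornerE euv // subrr.
- by apply/dinjectiveP.
- by rewrite size_image (leq_trans (size_polyD _ _)) // size_polyN geq_max szu.
Qed.

(** Indexing by subsets of a fixed finite type makes deletion of a root the operation [S :\ i], so
    that inductions on the number of roots keep [a] and [b] unchanged. *)
Definition Rset (K : fieldType) (I J : finType) (a : I -> K) (b : J -> K)
    (S : {set I}) (T : {set J}) : K :=
  \prod_(i in S) \prod_(j in T) (a i - b j).

Definition root_poly (K : fieldType) (I : finType) (a : I -> K) (S : {set I}) :
    {poly K} :=
  \prod_(i in S) ('X - (a i)%:P).

Section ProductsOverSets.
Variables (K : fieldType) (I J : finType) (a : I -> K) (b : J -> K).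
Implicit Types (S : {set I}) (T : {set J}) (x : K).

Lemma RsetDl S T i : i \in S ->
  Rset a b S T = \prod_(j in T) (a i - b j) * Rset a b (S :\ i) T.
Proof. by move=> iS; rewrite /Rset (big_setD1 i). Qed.

Lemma RsetDr S T j : j \in T ->
  Rset a b S T = \prod_(i in S) (a i - b j) * Rset a b S (T :\ j).
Proof.
move=> jT; rewrite /Rset -big_split.
by apply: eq_bigr => i _; rewrite (big_setD1 j).
Qed.

Lemma horner_root_poly S x : (root_poly a S).[x] = \prod_(i in S) (x - a i).
Proof. by rewrite horner_prod; apply: eq_bigr => i _; rewrite !hornerE. Qed.

Lemma horner_root_poly0 S i : i \in S -> (root_poly a S).[a i] = 0.
Proof. by move=> iS; rewrite horner_root_poly (big_setD1 i) //= subrr mul0r. Qed.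

Lemma root_polyD1 S i : i \in S ->
  root_poly a S = ('X - (a i)%:P) * root_poly a (S :\ i).
Proof. by move=> iS; rewrite /root_poly (big_setD1 i). Qed.

Lemma root_poly_monic S : root_poly a S \is monic.
Proof. exact: monic_prod_XsubC. Qed.

Lemma size_root_poly S : size (root_poly a S) = #|S|.+1.
Proof. by rewrite /root_poly -big_enum size_prod_XsubC cardE. Qed.

Lemma coef_root_poly S : (root_poly a S)`_#|S| = 1.
Proof.
by have /monicP := root_poly_monic S; rewrite lead_coefE size_root_poly.
Qed.

Lemma prod_subC S x :
  \prod_(i in S) (x - a i) = (-1) ^+ #|S| * \prod_(i in S) (a i - x).
Proof.
rewrite -prodr_const -big_split.
by apply: eq_bigr => i _ /=; rewrite mulN1r opprB.
Qed.

Lemma prod_sub_neq0 S i :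
  i \notin S -> {in i |: S &, injective a} -> \prod_(k in S) (a k - a i) != 0.
Proof.
move=> iS inj_a; apply/prodf_neq0 => k kS; rewrite subr_eq0.
apply: contraNneq iS => /inj_a <- //; first by rewrite setU1r.
exact: setU11.
Qed.

End ProductsOverSets.

Lemma Rset_sym (K : fieldType) (I J : finType) (a : I -> K) (b : J -> K) S T :
  Rset a b S T = (-1) ^+ (#|S| * #|T|) * Rset b a T S.
Proof.
rewrite /Rset (exchange_big _ _ _ _ _ (fun j i => b j - a i)) /=.
rewrite mulnC exprM -prodr_const -big_split; apply: eq_bigr => i _ /=.
exact: prod_subC.
Qed.

Lemma Rset_neq0 (K : fieldType) (I : finType) (a : I -> K) (X S : {set I}) :
  {in X &, injective a} -> S \subset X -> Rset a a (X :\: S) S != 0.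
Proof.
move=> inj_a /subsetP sSX; apply/prodf_neq0 => i /setDP[iX iS].
apply/prodf_neq0 => k kS; rewrite subr_eq0.
by apply: contraNneq iS => /inj_a -> //; apply: sSX.
Qed.

(* Both sides are polynomials in y, for y :: ys; they agree at the points b i,
   where only the sets T avoiding i contribute. *)
Lemma symmetric_interpolation (K : fieldType) (J : finType) (b : J -> K)
    (xs ys : seq K) (W : {set J}) :
  {in W &, injective b} -> #|W| = (size xs + size ys)%N ->
  \sum_(T : {set J} | (T \subset W) && (#|T| == size xs))
    (\prod_(x <- xs) \prod_(j in W :\: T) (x - b j)) *
    (\prod_(y <- ys) \prod_(j in T) (y - b j)) / Rset b b (W :\: T) T =
  \prod_(x <- xs) \prod_(y <- ys) (x - y).
Proof.
elim: ys W => [|y ys IH] W inj_b cardW.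
  rewrite addn0 in cardW.
  rewrite (big_pred1 W) => [|T /=]; last first.
    by rewrite -cardW; apply/andP/eqP => [[sTW /eqP cT]|-> //]; apply/eqP;
      rewrite eqEcard sTW cT /=.
  rewrite setDv /Rset big_set0 divr1 big_nil mulr1.
  by apply: eq_bigr => x _; rewrite big_set0 big_nil.
pose c T := (\prod_(x <- xs) \prod_(j in W :\: T) (x - b j)) *
  (\prod_(z <- ys) \prod_(j in T) (z - b j)) / Rset b b (W :\: T) T.
pose u :=
  \sum_(T : {set J} | (T \subset W) && (#|T| == size xs)) c T *: root_poly b T.
pose v :=
  (\prod_(x <- xs) \prod_(z <- ys) (x - z)) *: \prod_(x <- xs) (x%:P - 'X).
suff uv : u = v.
  transitivity u.[y].
    rewrite horner_sum; apply: eq_bigr => T _.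
    rewrite hornerZ horner_root_poly /c big_cons; ring.
  rewrite uv hornerZ horner_prod -big_split; apply: eq_bigr => x _ /=.
  by rewrite big_cons !hornerE mulrC.
have szW : (size xs < #|W|)%N by rewrite cardW /= -addSnnS leq_addr.
apply: (poly_interp_eq inj_b).
- apply: (leq_trans (size_sum _ _ _)); apply/bigmax_leqP => T /andP[_ /eqP cT].
  by apply: (leq_trans (size_scale_leq _ _)); rewrite size_root_poly cT.
- apply: (leq_trans (size_scale_leq _ _)); apply: leq_trans szW.
  elim: (xs) => [|x s IHs]; first by rewrite big_nil size_poly1.
  rewrite big_cons; apply: (leq_trans (size_polyMleq _ _)).
  rewrite -opprB size_polyN size_XsubC /=; exact: IHs.
move=> i iW; rewrite hornerZ horner_prod.
have inj_b1 : {in W :\ i &, injective b}.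
  by move=> j k /setD1P[_ jW] /setD1P[_ kW]; apply: inj_b.
have cardW1 : #|W :\ i| = (size xs + size ys)%N.
  by move: cardW; rewrite (cardsD1 i) iW /= addnS add1n => -[].
rewrite -(IH _ inj_b1 cardW1) mulr_suml horner_sum.
rewrite (bigID (fun T : {set J} => i \in T)) /= big1 ?add0r => [|T]; last first.
  by case/andP=> _ iT; rewrite hornerZ horner_root_poly0 ?mulr0.
apply: eq_big => [T|T /andP[/andP[sTW _] iT]].
  by rewrite subsetD1 -!andbA; congr (_ && _); rewrite andbC.
(* Splitting [i] off [W :\: T] produces the factors [x - b i] present in [v], and in the denominator
   a product over [T] that cancels the value of [root_poly b T] at [b i]. *)
have iWT : i \in W :\: T by rewrite inE iT.
have eqD : (W :\: T) :\ i = (W :\ i) :\: T.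
  by apply/setP=> j; rewrite !inE andbCA.
rewrite hornerZ horner_root_poly /c (RsetDl _ _ _ iWT) eqD.
under eq_bigr => x _ do rewrite (big_setD1 i) //= eqD.
rewrite big_split /= invfM.
under [X in _ = _ * X]eq_bigr => x _ do rewrite !hornerE.
have nz : \prod_(j in T) (b i - b j) != 0.
  rewrite prod_subC mulf_neq0 ?signr_eq0 // prod_sub_neq0 //.
  move=> j k /setU1P jT /setU1P kT; apply: inj_b.
    by case: jT => [-> //|]; apply: (subsetP sTW).
  by case: kT => [-> //|]; apply: (subsetP sTW).
move: (Rset b b _ T)^-1 => r; by field.
Qed.

(** * The double sum, its top coefficient and its values at roots *)

Section DoubleSum.
Variables (K : fieldType) (I J : finType) (a : I -> K) (b : J -> K).
Implicit Types (X S : {set I}) (Y T : {set J}).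

Definition weight X Y S T : K :=
  Rset a b S T * Rset a b (X :\: S) (Y :\: T) /
  (Rset a a S (X :\: S) * Rset b b T (Y :\: T)).

Definition double_sum (p q : nat) X Y : {poly K} :=
  \sum_(S : {set I} | (S \subset X) && (#|S| == p))
    \sum_(T : {set J} | (T \subset Y) && (#|T| == q))
      weight X Y S T *: (root_poly a S * root_poly b T).

(** The coefficient of x^(p+q), since each product of root polynomials is monic of degree p + q.
    Evaluating the double sum at a root reduces to this quantity with one root fewer. *)
Definition double_sum_lead (p q : nat) X Y : K :=
  \sum_(S : {set I} | (S \subset X) && (#|S| == p))
    \sum_(T : {set J} | (T \subset Y) && (#|T| == q)) weight X Y S T.

Lemma size_root_polyM S T :
  size (root_poly a S * root_poly b T) = (#|S| + #|T|).+1.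
Proof.
rewrite size_monicM ?root_poly_monic ?monic_neq0 ?root_poly_monic //.
by rewrite !size_root_poly addnS.
Qed.

Lemma size_double_sum p q X Y : (size (double_sum p q X Y) <= (p + q).+1)%N.
Proof.
apply: (leq_trans (size_sum _ _ _)); apply/bigmax_leqP => S /andP[_ /eqP cS].
apply: (leq_trans (size_sum _ _ _)); apply/bigmax_leqP => T /andP[_ /eqP cT].
by apply: (leq_trans (size_scale_leq _ _)); rewrite size_root_polyM cS cT.
Qed.

Lemma coef_double_sum p q X Y :
  (double_sum p q X Y)`_(p + q) = double_sum_lead p q X Y.
Proof.
rewrite coef_sum; apply: eq_bigr => S /andP[_ /eqP cS].
rewrite coef_sum; apply: eq_bigr => T /andP[_ /eqP cT].
have -> : (p + q)%N = (size (root_poly a S * root_poly b T)).-1.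
  by rewrite size_root_polyM cS cT.
rewrite coefZ -/(lead_coef _) lead_coef_monicM ?root_poly_monic //.
by rewrite (monicP (root_poly_monic _ _)) mulr1.
Qed.

(** Since [i] lies in [X :\: S], the value of [root_poly a S] cancels, up to the sign, the factors
    [a k - a i] of the denominator, while that of [root_poly b T] completes the product over
    [Y :\: T] to one over [Y]. *)
Lemma weightD1l X Y S T i :
    {in X &, injective a} -> i \in X -> S \subset X :\ i -> T \subset Y ->
  weight X Y S T * ((root_poly a S).[a i] * (root_poly b T).[a i]) =
  (-1) ^+ #|S| * (root_poly b Y).[a i] * weight (X :\ i) Y S T.
Proof.
move=> inj_a iX; rewrite subsetD1 => /andP[sSX iS] sTY; rewrite /weight.
have iXS : i \in X :\: S by rewrite inE iS.
have -> : (X :\ i) :\: S = (X :\: S) :\ i by apply/setP=> k; rewrite !inE andbCA.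
rewrite (RsetDl _ _ _ iXS) (RsetDr _ _ _ iXS) !horner_root_poly (prod_subC a).
have -> : \prod_(j in Y) (a i - b j) =
    \prod_(j in T) (a i - b j) * \prod_(j in Y :\: T) (a i - b j).
  by rewrite (big_setID T) /= (setIidPr sTY).
have nz : \prod_(k in S) (a k - a i) != 0.
  rewrite prod_sub_neq0 // => k l /setU1P kS /setU1P lS; apply: inj_a.
    by case: kS => [-> //|]; apply: (subsetP sSX).
  by case: lS => [-> //|]; apply: (subsetP sSX).
rewrite !invfM.
move: (Rset a a _ _)^-1 (Rset b b _ _)^-1 => r s. by field.
Qed.

Lemma horner_double_suml p q X Y i : {in X &, injective a} -> i \in X ->
  (double_sum p q X Y).[a i] =
  (-1) ^+ p * (root_poly b Y).[a i] * double_sum_lead p q (X :\ i) Y.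
Proof.
move=> inj_a iX; rewrite horner_sum mulr_sumr.
rewrite (bigID (fun S : {set I} => i \in S)) /= big1 ?add0r => [|S]; last first.
  case/andP=> _ iS; rewrite horner_sum big1 // => T _.
  by rewrite hornerZ hornerM horner_root_poly0 // mul0r mulr0.
apply: eq_big => [S|S /andP[/andP[sSX /eqP cS] iS]].
  by rewrite subsetD1 -!andbA; congr (_ && _); rewrite andbC.
rewrite horner_sum mulr_sumr; apply: eq_bigr => T /andP[sTY _].
by rewrite hornerZ hornerM weightD1l ?cS // subsetD1 sSX.
Qed.

End DoubleSum.

Lemma weight_sym (K : fieldType) (I J : finType) (a : I -> K) (b : J -> K)
    (X S : {set I}) (Y T : {set J}) : S \subset X -> T \subset Y ->
  weight a b X Y S T =
  (-1) ^+ (#|S| * #|T| + #|X :\: S| * #|Y :\: T|) * weight b a Y X T S.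
Proof.
move=> sSX sTY; rewrite /weight exprD !(Rset_sym a b).
rewrite [in RHS](mulrC (Rset b b _ _)); ring.
Qed.

(** Exchanges the two lists, so that evaluation at the roots [a i] also gives evaluation at the
    roots [b j]. The sign comes from the two numerator factors only. *)
Lemma double_sum_sym (K : fieldType) (I J : finType) (a : I -> K)
    (b : J -> K) p q (X : {set I}) (Y : {set J}) :
  double_sum a b p q X Y =
  (-1) ^+ (p * q + (#|X| - p) * (#|Y| - q)) *: double_sum b a q p Y X.
Proof.
rewrite /double_sum exchange_big /= scaler_sumr.
apply: eq_bigr => T /andP[sTY /eqP cT]; rewrite scaler_sumr.
apply: eq_bigr => S /andP[sSX /eqP cS].
by rewrite weight_sym // !cardsDS // cS cT scalerA (mulrC (root_poly a S)).
Qed.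

Lemma double_sum_lead_sym (K : fieldType) (I J : finType) (a : I -> K)
    (b : J -> K) p q (X : {set I}) (Y : {set J}) :
  double_sum_lead a b p q X Y =
  (-1) ^+ (p * q + (#|X| - p) * (#|Y| - q)) * double_sum_lead b a q p Y X.
Proof.
by rewrite -!coef_double_sum double_sum_sym coefZ (addnC p q).
Qed.

(** * The case where the first list has exactly p + q elements *)

Section Base.
Variables (K : fieldType) (I J : finType) (a : I -> K) (b : J -> K).
Implicit Types (X S : {set I}) (Y T : {set J}).

Lemma double_sum_lead_eq_card p q X Y :
    {in X &, injective a} -> {in Y &, injective b} ->
    #|X| = (p + q)%N -> #|Y| = (p + q)%N ->
  double_sum_lead a b p q X Y = 'C(p + q, p)%:R.
Proof.
move=> inj_a inj_b cX cY.
rewrite -cX -(cards_draws X p) -sum1_card natr_sum.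
rewrite (eq_bigl (fun S : {set I} => (S \subset X) && (#|S| == p))); last first.
  by move=> S; rewrite inE.
apply: eq_bigr => S /andP[sSX /eqP cS].
have cXS : #|X :\: S| = q by rewrite cardsDS // cX cS addKn.
(* For fixed [S] the sum over [T] is an interpolation formula at the points of [Y], with [X :\: S]
   supplying [xs] and [S] supplying [ys]. *)
have := symmetric_interpolation (b := b) (xs := [seq a i | i in X :\: S])
  (ys := [seq a i | i in S]) inj_b.
rewrite !size_image cXS cS => /(_ (etrans cY (addnC _ _))).
under [X in X = _ -> _]eq_bigr => T _ do rewrite !big_image /=.
rewrite big_image /=.
under [X in _ = X -> _]eq_bigr => i _ do rewrite big_image /=.
rewrite -/(Rset a a (X :\: S) S) => interp.
have nzR : Rset a a (X :\: S) S != 0 by apply: Rset_neq0.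
rewrite -[RHS](divff nzR) -[in X in _ = X / _]interp mulr_suml.
apply: eq_bigr => T /andP[sTY /eqP cT].
have cYT : #|Y :\: T| = p by rewrite cardsDS // cY cT addnK.
(* Reversing both denominator factors gives the sign (-1)^(pq) twice, hence no sign. *)
rewrite /weight (Rset_sym a a S) (Rset_sym b b T) cXS cS cYT cT (mulnC q p).
rewrite (mulrACA ((-1) ^+ (p * q))) -expr2 sqrr_sign mul1r invfM -/(Rset a b S T).
rewrite -/(Rset a b (X :\: S) (Y :\: T)).
move: (Rset a a _ _)^-1 (Rset b b _ _)^-1 => r s; ring.
Qed.

(** The degree is at most p + q, which is less than [#|Y|], so the values at the points [b j]
    suffice; [lead] is the form in which the induction on [#|Y|] supplies them. *)
Lemma double_sum_card p q X Y :
    {in X &, injective a} -> {in Y &, injective b} ->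
    #|X| = (p + q)%N -> (p + q < #|Y|)%N ->
    {in Y, forall j, double_sum_lead a b p q X (Y :\ j) = 'C(p + q, p)%:R} ->
  double_sum a b p q X Y = 'C(p + q, p)%:R *: root_poly a X.
Proof.
move=> inj_a inj_b cX ltY lead; apply: (poly_interp_eq inj_b).
- exact: leq_trans (size_double_sum _ _ _ _ _ _) _.
- by apply: leq_trans (size_scale_leq _ _) _; rewrite size_root_poly cX.
move=> j jY; rewrite hornerZ double_sum_sym hornerZ horner_double_suml //.
(* Going from [Y] to [Y :\ j] lowers the exponent q(#|Y| - q) of the symmetry sign by q, which
   compensates the (-1)^q from evaluation. *)
rewrite -(lead j jY) (double_sum_lead_sym a b).
move: ltY; rewrite (cardsD1 j Y) jY cX add1n ltnS addKn => leY.
rewrite subSn ?(leq_trans (leq_addl _ _) leY) // mulnS.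
have sqr_sign : (-1 : K) ^+ q * (-1) ^+ q = 1 by rewrite -expr2 sqrr_sign.
by rewrite !exprD; ring: sqr_sign.
Qed.

Lemma double_sum_lead_card p q X Y :
    {in X &, injective a} -> {in Y &, injective b} ->
    #|X| = (p + q)%N -> (p + q <= #|Y|)%N ->
  double_sum_lead a b p q X Y = 'C(p + q, p)%:R.
Proof.
move=> inj_a inj_b cX.
elim: {Y}#|Y| {-2}Y (erefl #|Y|) inj_b => [|k IH] Y cY inj_b leY.
  by apply: double_sum_lead_eq_card => //; lia.
case: (ltngtP (p + q) #|Y|) => [ltY|| eqY]; [|lia|exact: double_sum_lead_eq_card].
rewrite -coef_double_sum double_sum_card // ?coefZ.
  by rewrite -[in X in _ * X]cX coef_root_poly mulr1.
move=> j jY; apply: IH.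
- by move: cY; rewrite (cardsD1 j) jY => -[].
- by move=> u v /setD1P[_ uY] /setD1P[_ vY]; apply: inj_b.
- by move: ltY; rewrite (cardsD1 j) jY.
Qed.

End Base.

(** * Determinants of subresultant type *)

(* The i-th row polynomial of the subresultant matrix with c rows from f among
   N; its coefficient of x^(N - j.+1 + d) is the entry in column j. *)
Definition sres_row (R : comNzRingType) (c N : nat) (f g : {poly R}) (i : nat) :
    {poly R} :=
  if (i < c)%N then 'X^(c - i.+1) * f else 'X^(N - i.+1) * g.

(** For the rows [sres_row], with N = m + n - 2d, the determinant is the d-th principal subresultant
    coefficient. *)
Definition coef_mx (R : comNzRingType) (N d : nat) (r : nat -> {poly R}) :
    'M[R]_N :=
  \matrix_(i, j) (r i)`_(N - j.+1 + d).

(** The last column is left free: the row polynomials there give the subresultant, their values or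
    coefficients give its values or coefficients. *)
Definition bordered_mx (R : comNzRingType) (N d : nat) (r : nat -> {poly R})
    (v : nat -> R) : 'M[R]_N :=
  \matrix_(i, j) if j.+1 == N then v i else (r i)`_(N - j.+1 + d).

(** The operation is left multiplication by a unitriangular matrix. The hypothesis on [e] discards
    the row [F n], which lies outside the matrix. *)
Lemma det_sub_next_row (R : comNzRingType) (n : nat) (F : nat -> nat -> R)
    (e : nat -> R) : e n.-1 = 0 ->
  \det (\matrix_(i < n, j < n) (F i j - e i * F i.+1 j)) =
  \det (\matrix_(i < n, j < n) F i j).
Proof.
move=> e_last.
pose L : 'M[R]_n := \matrix_(i, k) ((i == k)%:R - e i * (k == i.+1 :> nat)%:R).
have detL : \det L = 1.
  rewrite -det_tr det_trig ?big1 // => [i _|].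
    by rewrite !mxE eqxx ltn_eqF ?mulr0 ?subr0.
  apply/is_trig_mxP => i k ik; rewrite !mxE -val_eqE.
  by rewrite gtn_eqF //= ltn_eqF ?mulr0 ?subr0 //; apply: leqW.
rewrite -[RHS]mul1r -detL -det_mulmx; congr (\det _).
apply/matrixP => i j; rewrite !mxE.
under eq_bigr => k _ do rewrite !mxE mulrBl -mulrA.
rewrite sumrB -mulr_sumr (bigD1 i) //= eqxx mul1r.
rewrite big1 ?addr0 => [|k ki]; last first.
  by rewrite eq_sym (negPf ki) mul0r.
congr (_ - _); case: (ltnP i.+1 n) => [ltin|leni].
  rewrite (bigD1 (Ordinal ltin)) //= eqxx mul1r big1 ?addr0 // => k ki.
  by rewrite -[k == _ :> nat]/(k == Ordinal ltin) (negPf ki) mul0r.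
have -> : nat_of_ord i = n.-1 by have := ltn_ord i; lia.
by rewrite e_last !mul0r.
Qed.

(** Right multiplication by a unitriangular matrix. Columns are shifted by one so that [F i 0] can
    stand for a zero column preceding the first. *)
Lemma det_sub_prev_col (R : comNzRingType) (n : nat) (F : nat -> nat -> R)
    (x : R) :
    (forall i, (i < n)%N -> F i 0 = 0) ->
  \det (\matrix_(i < n, j < n) (F i j.+1 - x * F i j)) =
  \det (\matrix_(i < n, j < n) F i j.+1).
Proof.
move=> F0.
pose U : 'M[R]_n := \matrix_(k, j) ((k == j)%:R - x * (k.+1 == j :> nat)%:R).
have detU : \det U = 1.
  rewrite -det_tr det_trig ?big1 // => [i _|].
    by rewrite !mxE eqxx gtn_eqF ?mulr0 ?subr0.
  apply/is_trig_mxP => i k ik; rewrite !mxE -val_eqE.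
  by rewrite gtn_eqF //= gtn_eqF ?mulr0 ?subr0 //; apply: leqW.
rewrite -[RHS]mulr1 -detU -det_mulmx; congr (\det _).
apply/matrixP => i j; rewrite !mxE.
under eq_bigr => k _ do rewrite !mxE mulrBr mulrCA.
rewrite sumrB -mulr_sumr (bigD1 j) //= eqxx mulr1.
rewrite big1 ?addr0 => [|k kj]; last first.
  by rewrite (negPf kj) mulr0.
congr (_ - _ * _); case: j => -[|j] ltj /=.
  by rewrite big1 ?F0 // => k _; rewrite mulr0.
rewrite (bigD1 (Ordinal (ltnW ltj))) //= eqxx mulr1 big1 ?addr0 // => k kj.
by rewrite eqSS -[k == _ :> nat]/(k == Ordinal (ltnW ltj)) (negPf kj) mulr0.
Qed.

Section Subresultants.
Variable K : fieldType.
Implicit Types (f g : {poly K}).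

(** By c + m = N + d, the shift by c - i - 1 turns the index N - j - 1 + d into m - j + i; outside
    the range from 0 to m both sides vanish. *)
Lemma coef_row c N d m f i j : (i < c)%N -> (j < N)%N -> (c + m = N + d)%N ->
    (size f <= m.+1)%N ->
  ('X^(c - i.+1) * f)`_(N - j.+1 + d) = formal_coef m f (m%:Z - j%:Z + i%:Z).
Proof.
move=> ic jN cmNd szf; rewrite coefXnM /formal_coef.
case: ifPn => lt1; case: ifPn => // le1; first by exfalso; lia.
- by congr (f`_ _); lia.
- by rewrite nth_default // (leq_trans szf) //; clear szf; lia.
Qed.

Lemma SresE m n d f g : (d <= m)%N -> (d <= n)%N ->
    (size f <= m.+1)%N -> (size g <= n.+1)%N ->
  Sres m n d f g =
  let r := sres_row (n - d) (n - d + (m - d)) f g in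
  \det (bordered_mx (n - d + (m - d)) d (fun i => map_poly polyC (r i)) r).
Proof.
move=> dm dn szf szg; rewrite /Sres; congr (\det _); apply/matrixP => i j.
rewrite !mxE; case: splitP => k ->; rewrite !mxE; case: ifP => jN.
- by rewrite /sres_row ltn_ord.
- rewrite coef_map /= /sres_row ltn_ord (@coef_row _ _ _ m) //; lia.
- rewrite /sres_row ltnNge leq_addr /=; congr ('X^_ * _); lia.
rewrite coef_map /= /sres_row ltnNge leq_addr /=; congr (_%:P).
rewrite -(@coef_row (m - d) (n - d + (m - d)) d n) //; try lia.
congr (('X^_ * _)`_ _); lia.
Qed.

(** Only the last column is not constant, so expansion along it has constant cofactors. *)
Lemma det_bordered_coef N d r e :
  (\det (bordered_mx N.+1 d (fun i => map_poly polyC (r i)) r))`_e =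
  \det (bordered_mx N.+1 d r (fun i => (r i)`_e)) :> K.
Proof.
rewrite !(expand_det_col _ ord_max) coef_sum; apply: eq_bigr => i _.
rewrite !mxE eqxx.
suff -> :
    cofactor (bordered_mx N.+1 d (fun i => map_poly polyC (r i)) r) i ord_max =
    (cofactor (bordered_mx N.+1 d r (fun i => (r i)`_e)) i ord_max)%:P.
  by rewrite coefMC.
rewrite /cofactor polyCM rmorph_sign; congr (_ * _).
rewrite -det_map_mx; congr (\det _); apply/matrixP => k l; rewrite !mxE.
by rewrite lift_max eqSS ltn_eqF // coef_map.
Qed.

Lemma det_bordered_horner N d r x :
  (\det (bordered_mx N d (fun i => map_poly polyC (r i)) r)).[x] =
  \det (bordered_mx N d r (fun i => (r i).[x])) :> K.
Proof.
rewrite -[LHS]/(horner_eval x _) -det_map_mx; congr (\det _).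
apply/matrixP => i j; rewrite !mxE /horner_eval; case: ifP => // _.
by rewrite coef_map; apply: hornerC.
Qed.

(* For e > d the determinant giving the coefficient of x^e has two equal
   columns. *)
Lemma size_det_bordered N d (r : nat -> {poly K}) :
  (forall i, (i <= N)%N -> (size (r i) <= N.+1 + d)%N) ->
  (size (\det (bordered_mx N.+1 d (fun i => map_poly polyC (r i)) r))
     <= d.+1)%N.
Proof.
move=> szr; apply/leq_sizeP => e de; rewrite det_bordered_coef.
case: (ltnP e (N.+1 + d)) => [ltN|geN].
  (* Column N + d - e is the one that holds the coefficients of x^e. *)
  have jP : (N + d - e < N.+1)%N by lia.
  rewrite -det_tr; apply: (@determinant_alternate _ _ _ (Ordinal jP) ord_max).
    by apply/eqP => /(congr1 val) /=; lia.
  move=> i; rewrite !mxE /= eqxx ifN; last by lia.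
  by congr ((r i)`_ _); lia.
(* Here e exceeds the degree of every row, so the last column is zero. *)
rewrite (expand_det_col _ ord_max) big1 // => i _.
by rewrite mxE eqxx nth_default ?mul0r // (leq_trans _ geN) // szr // -ltnS.
Qed.

Lemma det_bordered_lead N d r :
  (\det (bordered_mx N.+1 d (fun i => map_poly polyC (r i)) r))`_d =
  \det (coef_mx N.+1 d r) :> K.
Proof.
rewrite det_bordered_coef; congr (\det _); apply/matrixP=> i j.
rewrite !mxE; case: ifP => // /eqP[->]; congr ((r i)`_ _); lia.
Qed.

(* Subtracting x times the next row from the rows coming from g makes every row
   but the last divisible by 'X - x. *)
Lemma det_bordered_factor c N d f g x :
    (c <= N)%N -> (c + size f <= (N + d).+1)%N -> (size g <= c + d.+1)%N ->
  \det (bordered_mx N.+1 d (sres_row c N.+1 (('X - x%:P) * f) g)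
           (fun i => (sres_row c N.+1 (('X - x%:P) * f) g i).[x])) =
  g.[x] * \det (coef_mx N d (sres_row c N f g)).
Proof.
move=> leN szf szg.
set r := sres_row c N.+1 _ g; set s := sres_row c N f g.
(* The first [c] rows are already multiples of ['X - x%:P], and row [N] has no successor. *)
pose e i := if (c <= i < N)%N then x else 0.
pose F i j := if j.+1 == N.+1 then (r i).[x] else (r i)`_(N.+1 - j.+1 + d).
have e_last : e N.+1.-1 = 0 by rewrite /e ltnn andbF.
rewrite -[\det _](@det_sub_next_row _ N.+1 F e e_last).
have r_step i : (i < N)%N -> r i - e i *: r i.+1 = ('X - x%:P) * s i.
  move=> ltiN; rewrite /r /s /e /sres_row ltiN andbT.
  case: (ltnP i c) => ic; first by rewrite scale0r subr0 mulrCA.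
  rewrite ltnNge leqW //= subSS (_ : N.+1 - i.+2 = N - i.+1)%N; last by lia.
  by rewrite -mul_polyC (_ : N - i = (N - i.+1).+1)%N ?exprS; [ring|lia].
have r_last : r N = g by rewrite /r /sres_row ltnNge leN subnn mul1r.
(* After the row operations, [g.[x]] in the last row is the only entry of the last column that can
   be nonzero. *)
rewrite (expand_det_col _ ord_max) (bigD1 ord_max) //=.
rewrite big1 ?addr0 => [|i]; last first.
  rewrite -val_eqE /= => iN; have ltiN : (i < N)%N by have := ltn_ord i; lia.
  rewrite !mxE /F eqxx -hornerZ -hornerN -hornerD r_step //.
  by rewrite hornerM hornerXsubC subrr !mul0r.
rewrite !mxE /F eqxx r_last e_last mul0r subr0; congr (_ * _).
rewrite /cofactor -signr_odd oddD addbb mul1r.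
(* Multiplying [s i] by ['X - x%:P] turns its coefficients into [G i j.+1 - x * G i j], a column
   operation; [G i 0] vanishes by the size bounds. *)
pose G i j := (s i)`_(N + d - j).
have -> : coef_mx N d s = \matrix_(i < N, j < N) G i j.+1.
  by apply/matrixP=> i j; rewrite !mxE; congr ((s i)`_ _); have := ltn_ord j; lia.
rewrite -(@det_sub_prev_col _ N G x) => [|i ltiN]; last first.
  rewrite /G subn0 nth_default // /s /sres_row; case: ifPn => ic.
    apply: (leq_trans (size_polyMleq _ _)); rewrite size_polyXn.
    by move: (size f) szf => k; lia.
  apply: (leq_trans (size_polyMleq _ _)); rewrite size_polyXn.
  by move: (size g) szg => k; lia.
congr (\det _); apply/matrixP=> i j; rewrite !mxE !lift_max eqSS ltn_eqF //.
rewrite -coefZ -coefN -coefD r_step // mulrBl coefB coefXM coefCM /G.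
by rewrite ifN; [congr ((s i)`_ _ - _ * (s i)`_ _)|]; have /= := ltn_ord j; lia.
Qed.

(** With [N = c] no row comes from [g], and the shifts of the monic [f] form an upper unitriangular
    matrix. *)
Lemma det_coef_mx_triangular c d f g : f \is monic -> size f = d.+1 ->
  \det (coef_mx c d (sres_row c c f g)) = 1.
Proof.
move=> /monicP mon_f szf; rewrite -det_tr det_trig ?big1 // => [i _|].
  rewrite !mxE /sres_row ltn_ord coefXnM ltnNge leq_addr /= addKn.
  by rewrite -[RHS]mon_f lead_coefE szf.
apply/is_trig_mxP => i j ij; rewrite !mxE /sres_row ltn_ord coefXnM.
case: ifP => // _; rewrite nth_default // szf; have := ltn_ord j; lia.
Qed.

(** As in the unbordered case, except that the last diagonal entry is [f] itself. *)
Lemma det_bordered_triangular c d f g : f \is monic -> size f = d.+1 ->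
  \det (bordered_mx c.+1 d (fun i => map_poly polyC (sres_row c.+1 c.+1 f g i))
     (sres_row c.+1 c.+1 f g)) = f.
Proof.
move=> /monicP mon_f szf; rewrite -det_tr det_trig.
  rewrite (bigD1 ord_max) //= big1 ?mulr1 => [|i i_last]; rewrite !mxE.
    by rewrite eqxx /sres_row ltnSn subnn mul1r.
  rewrite ifN; last by move: i_last; rewrite -val_eqE.
  rewrite coef_map /sres_row ltn_ord coefXnM ltnNge leq_addr /= addKn.
  by rewrite -[RHS]/(1%:P) -mon_f lead_coefE szf.
apply/is_trig_mxP => i j ij; rewrite !mxE ifN; last by have := ltn_ord j; lia.
rewrite coef_map /sres_row ltn_ord coefXnM.
case: ifP => // _; rewrite nth_default // szf; have := ltn_ord j; lia.
Qed.

End Subresultants.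

(** * Comparison of the double sum with the subresultant *)

Section DoubleSumSubresultant.
Variables (K : fieldType) (I J : finType) (a : I -> K) (b : J -> K) (p q : nat).
Implicit Types (X : {set I}) (Y : {set J}).

(** Here [k] is meant to be [#|X| - (p + q)], the number of rows coming from [root_poly b Y]. *)
Let row (X : {set I}) (Y : {set J}) k :=
  sres_row (#|Y| - (p + q)) (#|Y| - (p + q) + k) (root_poly a X) (root_poly b Y).

(** At [a i] both sides have the factor [(root_poly b Y).[a i]], and evaluation contributes the
    extra sign (-1)^p. With [lead] as a hypothesis, the step serves both the induction on top
    coefficients and the final identity. *)
Lemma double_sum_step X Y k : {in X &, injective a} -> (p + q <= #|Y|)%N ->
    #|X| = (p + q + k.+1)%N ->
    {in X, forall i, double_sum_lead a b p q (X :\ i) Y =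
      (-1) ^+ (p * k) * 'C(p + q, p)%:R *
      \det (coef_mx (#|Y| - (p + q) + k) (p + q) (row (X :\ i) Y k))} ->
  double_sum a b p q X Y =
  ((-1) ^+ (p * k.+1) * 'C(p + q, p)%:R) *:
    \det (bordered_mx (#|Y| - (p + q) + k).+1 (p + q)
            (fun i => map_poly polyC (row X Y k.+1 i)) (row X Y k.+1)).
Proof.
move=> inj_a leY cX lead; apply: (poly_interp_eq inj_a).
- apply: leq_trans (size_double_sum _ _ _ _ _ _) _.
  by rewrite cX addnS ltnS leq_addr.
- apply: leq_trans (size_scale_leq _ _) _.
  apply: (@leq_trans (p + q).+1); last by rewrite cX addnS ltnS leq_addr.
  apply: size_det_bordered => i leiN; rewrite /row /sres_row; case: ifPn => ic.
    apply: (leq_trans (size_polyMleq _ _)); rewrite size_polyXn size_root_poly cX.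
    by lia.
  apply: (leq_trans (size_polyMleq _ _)); rewrite size_polyXn size_root_poly.
  by lia.
move=> i iX; rewrite horner_double_suml // lead // hornerZ det_bordered_horner.
rewrite /row addnS (root_polyD1 a iX) det_bordered_factor.
- by rewrite mulnS exprD; ring.
- exact: leq_addr.
- by rewrite size_root_poly; move: cX; rewrite (cardsD1 i) iX; lia.
- by rewrite size_root_poly; lia.
Qed.

Lemma double_sum_lead_subresultant X Y k :
    {in X &, injective a} -> {in Y &, injective b} ->
    (p + q <= #|Y|)%N -> #|X| = (p + q + k)%N ->
  double_sum_lead a b p q X Y =
  (-1) ^+ (p * k) * 'C(p + q, p)%:R *
    \det (coef_mx (#|Y| - (p + q) + k) (p + q) (row X Y k)).
Proof.
move=> inj_a inj_b leY; elim: k X inj_a => [|k IH] X inj_a cX.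
  rewrite addn0 in cX.
  rewrite double_sum_lead_card // muln0 mul1r addn0 /row addn0.
  by rewrite det_coef_mx_triangular ?mulr1 ?root_poly_monic // size_root_poly cX.
rewrite -coef_double_sum (@double_sum_step X Y k) //.
  by rewrite coefZ det_bordered_lead /row addnS.
move=> i iX; apply: IH.
  by move=> u v /setD1P[_ uX] /setD1P[_ vX]; apply: inj_a.
by move: cX; rewrite (cardsD1 i) iX; lia.
Qed.

Lemma double_sum_subresultant X Y :
    {in X &, injective a} -> {in Y &, injective b} ->
    (p + q <= #|X|)%N -> (p + q <= #|Y|)%N -> (p + q < maxn #|X| #|Y|)%N ->
  double_sum a b p q X Y =
  ((-1) ^+ (p * (#|X| - (p + q))) * 'C(p + q, p)%:R) *:
    Sres #|X| #|Y| (p + q) (root_poly a X) (root_poly b Y).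
Proof.
move=> inj_a inj_b leX leY lt_max; rewrite SresE ?size_root_poly //=.
case def_k : (#|X| - (p + q))%N => [|k]; last first.
  rewrite addnS; have cX : #|X| = (p + q + k.+1)%N by lia.
  rewrite (@double_sum_step X Y k) //; first by rewrite /row addnS.
  move=> i iX; apply: double_sum_lead_subresultant => //.
    by move=> u v /setD1P[_ uX] /setD1P[_ vX]; apply: inj_a.
  by move: cX; rewrite (cardsD1 i) iX; lia.
(* Now [X] has too few points to determine a polynomial of degree p + q, but [Y] has enough, by the
   strict inequality on the maximum. *)
have cX : #|X| = (p + q)%N by lia.
have ltY : (p + q < #|Y|)%N by move: lt_max; rewrite cX; lia.
have -> : (#|Y| - (p + q) + 0 = (#|Y| - (p + q)).-1.+1)%N by lia.
have -> : (#|Y| - (p + q) = (#|Y| - (p + q)).-1.+1)%N by lia.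
rewrite det_bordered_triangular ?root_poly_monic ?size_root_poly ?cX //.
rewrite muln0 mul1r; apply: double_sum_card => // j jY.
apply: double_sum_lead_card => //; last by move: ltY; rewrite (cardsD1 j) jY.
by move=> u v /setD1P[_ uY] /setD1P[_ vY]; apply: inj_b.
Qed.

End DoubleSumSubresultant.

(** * Passage to indeterminates and rational functions *)

Lemma SylvE (K : fieldType) p q m n (A : m.-tuple K) (B : n.-tuple K) :
  Sylv p q A B = double_sum (tnth A) (tnth B) p q [set: 'I_m] [set: 'I_n].
Proof.
have RprodE k l (U : k.-tuple K) (V : l.-tuple K)
      (S : {set 'I_k}) (T : {set 'I_l}) :
    Rprod (sublist U S) (sublist V T) = Rset (tnth U) (tnth V) S T.
  by rewrite /Rprod /sublist big_image; apply: eq_bigr => i _; rewrite big_image.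
have RXE k (U : k.-tuple K) (S : {set 'I_k}) :
    RX (sublist U S) = root_poly (tnth U) S.
  by rewrite /RX /Rprod big_seq1 big_map /sublist big_image.
rewrite /Sylv /double_sum; apply: eq_big => [S|S _]; first by rewrite subsetT.
apply: eq_big => [T|T _]; first by rewrite subsetT.
by rewrite !RXE !RprodE mulrC mul_polyC /weight !setTD.
Qed.

(** The formal degrees are parameters, so no condition on leading coefficients arises. *)
Lemma Sres_map (R S : comNzRingType) (phi : {rmorphism R -> S}) m n d f g :
  map_poly phi (Sres m n d f g) = Sres m n d (map_poly phi f) (map_poly phi g).
Proof.
have rowsE k c N h i j :
    map_poly phi (Sres_rows k c N h i j) = Sres_rows k c N (map_poly phi h) i j.
  rewrite !mxE; case: ifP => _; first by rewrite rmorphM /= map_polyXn.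
  rewrite map_polyC /= /formal_coef.
  by case: ifP => _; rewrite ?coef_map ?rmorph0.
rewrite -det_map_mx map_col_mx; congr (\det (col_mx _ _)); apply/matrixP => i j;
  by rewrite -rowsE [LHS]mxE.
Qed.

Lemma map_prod_tuple (R S : comNzRingType) (phi : {rmorphism R -> S}) k
    (U : k.-tuple R) :
  map_poly phi (\prod_(u <- U) ('X - u%:P)) =
  \prod_(i < k) ('X - (phi (tnth U i))%:P).
Proof.
rewrite rmorph_prod big_tuple; apply: eq_bigr => i _.
by rewrite rmorphB /= map_polyX map_polyC.
Qed.

Lemma toratfunX k (i : 'I_k) : toratfun 'X_i = tofrac 'X_i.
Proof. by rewrite /toratfun map_mpolyX. Qed.

Theorem theorem1 (m n p q d : nat) (hd : d = (p + q)%N)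
    (hdmn : (d < minn m n)%N \/ (d = minn m n /\ m <> n)) :
  map_poly (@toratfun (m + n)) (Sres m n d (polyA m n) (polyB m n)) =
  ((-1) ^+ (p * (m - d)) / ('C(d, p))%:R : ratfun (m + n)) *:
    Sylv p q (map_tuple (@tofrac _) (varsA rat m n))
             (map_tuple (@tofrac _) (varsB rat m n)).
Proof.
pose phi : {rmorphism {mpoly int[m + n]} -> ratfun (m + n)} :=
  (@tofrac _) \o (map_mpoly (intr : int -> rat)).
set A := map_tuple _ _; set B := map_tuple _ _.
have tnthA i : tnth A i = tofrac 'X_(lshift n i) by rewrite tnth_map tnth_mktuple.
have tnthB i : tnth B i = tofrac 'X_(rshift m i) by rewrite tnth_map tnth_mktuple.
rewrite -[map_poly _ _]/(map_poly phi _) Sres_map.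
have -> : map_poly phi (polyA m n) = root_poly (tnth A) setT.
  rewrite map_prod_tuple /root_poly; apply: eq_big => i; first by rewrite inE.
  by rewrite tnthA tnth_mktuple -toratfunX.
have -> : map_poly phi (polyB m n) = root_poly (tnth B) setT.
  rewrite map_prod_tuple /root_poly; apply: eq_big => i; first by rewrite inE.
  by rewrite tnthB tnth_mktuple -toratfunX.
(* The roots must be pairwise distinct in the fraction field; the coefficient at the monomial
   [U_(i)] separates the indeterminates. *)
have Xinj (i j : 'I_(m + n)) :
    tofrac ('X_i : {mpoly rat[m + n]}) = tofrac 'X_j -> i = j.
  move/eqP; rewrite tofrac_eq => /eqP/(congr1 (mcoeff U_(i)%MM))/eqP.
  by rewrite !mcoeffXU eqxx; case: (j =P i) => // _; rewrite oner_eq0.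
have := @double_sum_subresultant _ _ _ (tnth A) (tnth B) p q setT setT.
rewrite !cardsT !card_ord -hd SylvE => -> //; first last.
- by lia.
- by lia.
- by lia.
- by move=> i j _ _; rewrite !tnthB => /Xinj/rshift_inj.
- by move=> i j _ _; rewrite !tnthA => /Xinj/lshift_inj.
(* The binomial coefficient is a positive integer because p <= d, and it stays nonzero in
   characteristic 0. *)
have nzC : 'C(d, p)%:R != 0 :> ratfun (m + n).
  rewrite -(rmorph_nat (@tofrac _)) tofrac_eq0.
  rewrite -(rmorph_nat (@mpolyC _ _)) mpolyC_eq0.
  by rewrite Num.Theory.pnatr_eq0 -lt0n bin_gt0; lia.
by rewrite scalerA mulrACA -expr2 sqrr_sign mulVf // mul1r scale1r.
Qed.
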